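(* Let $G_\infty$ be the infinite hexagonal grid. For every finite subset $W\subset V(G_\infty)$: (1) $|\mathcal{N}(W)|\ge \sqrt{6}\,\sqrt{|W|}$; (2) $|\mathcal{E}(W)|\ge \sqrt{6}\,\sqrt{|W|}$; (3) $|\mathcal{B}(W)|\ge c\sqrt{|W|+\tfrac{c^2}{4}}-\tfrac{c^2}{2}$ with $c=\sqrt{6}$. Moreover, in each of (1), (2), (3) the constant $c=\sqrt6$ is optimal, i.e. the inequality fails for some finite $W\subset V(G_\infty)$ if $\sqrt6$ is replaced by any larger constant.
   Context: The infinite hexagonal grid $G_\infty$ is the graph formed by the vertices and edges of the tiling of the plane by regular hexagons (three hexagons meet at each vertex). For a graph $G=(V,E)$ and $W\subseteq V$: $\mathcal{N}(W)=\{x\in V\setminus W : \{x,y\}\in E \text{ for some } y\in W\}$ (neighbor vertices), $\mathcal{B}(W)=\{x\in W : \{x,y\}\in E \text{ for some } y\in V\setminus W\}$ (boundary vertices), and $\mathcal{E}(W)=\{\{x,y\}\in E : x\in W,\ y\in V\setminus W\}$ (outgoing edges). *)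

(* Defs.v *)
From mathcomp Require Import all_boot all_order all_algebra finmap.
From mathcomp Require Import reals.
From mathcomp Require Import zify ring lra.

Set Implicit Arguments.
Unset Strict Implicit.
Unset Printing Implicit Defensive.

Import Order.TTheory GRing.Theory Num.Theory.
Local Open Scope fset_scope.
Local Open Scope ring_scope.

(* A locally finite simple graph on [V] is given by the finite sets [nb x] of
   vertices adjacent to [x]; [V] itself may be infinite. *)
Section LocallyFiniteGraph.
Variables (V : choiceType) (nb : V -> {fset V}).
Implicit Type W : {fset V}.

Definition neighbor_vertices W : {fset V} :=
  [fset x | y in W, x in nb y & x \notin W].

Definition boundary_vertices W : {fset V} :=
  [fset x in W | ~~ (nb x `<=` W)].

(* Edges are unordered pairs. *)
Definition outgoing_edges W : {fset {fset V}} :=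
  [fset [fset x; y] | x in W, y in nb x & y \notin W].

Lemma neighbor_verticesP W x :
  reflect (x \notin W /\ exists2 y, y \in W & x \in nb y)
          (x \in neighbor_vertices W).
Proof.
apply: (iffP (imfset2P _ _ _ _ _)) => /=.
  by case=> y yW [z]; rewrite !inE => /andP[zy zW] ->; split=> //; exists y.
by case=> xW [y yW xy]; exists y => //; exists x; rewrite // !inE xy.
Qed.

Lemma boundary_verticesP W x :
  reflect (x \in W /\ exists2 y, y \notin W & y \in nb x)
          (x \in boundary_vertices W).
Proof.
rewrite !inE /=; apply: (iffP andP) => -[xW].
  by move=> /fsubsetPn[y yx yW]; split=> //; exists y.
by case=> y yW yx; split=> //; apply/fsubsetPn; exists y.
Qed.

Lemma outgoing_edgesP W e :
  reflect (exists x y, [/\ e = [fset x; y], y \in nb x, x \in W & y \notin W])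
          (e \in outgoing_edges W).
Proof.
apply: (iffP (imfset2P _ _ _ _ _)) => /=.
  by case=> x xW [y]; rewrite !inE => /andP[yx yW] ->; exists x, y.
by case=> x [y] [-> yx xW yW]; exists x => //; exists y; rewrite // !inE yx.
Qed.

End LocallyFiniteGraph.

(* The infinite hexagonal grid, in coordinates. The grid is bipartite and each
   class is a triangular lattice, so a vertex is a pair of lattice coordinates
   together with its class. Lemmas [hex_pos_inj], [hex_vertexP] and [hex_edgeP]
   below identify this graph with the vertices and edges of the tiling of the
   Euclidean plane by regular hexagons. *)
Definition hex_vertex : Type := (int * int * bool)%type.

Definition hex_nb (v : hex_vertex) : {fset hex_vertex} :=
  let: (a, b, s) := v in
  if s then [fset ((a, b), false); ((a + 1, b), false); ((a, b + 1), false)]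
  else [fset ((a, b), true); ((a - 1, b), true); ((a, b - 1), true)].

Lemma hex_nb_sym (v w : hex_vertex) : (v \in hex_nb w) = (w \in hex_nb v).
Proof.
case: v w => [[a b] []] [[c d] []]; rewrite !inE -!pair_eqE /= -!pair_eqE /=;
  rewrite ?andbF ?andbT //; lia.
Qed.

Lemma hex_nb_irr (v : hex_vertex) : v \notin hex_nb v.
Proof. by case: v => [[a b] []]; rewrite !inE -!pair_eqE /= ?andbF. Qed.

Section HexagonalTiling.
Variable R : realType.

(* The tiles are the regular hexagons of side 1, two of whose sides are
   vertical, centred at the points i (sqrt 3, 0) + j (sqrt 3 / 2, 3 / 2). *)
Definition tile_center (i j : int) : R * R :=
  (Num.sqrt 3 * (i%:~R + j%:~R / 2), 3 / 2 * j%:~R).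

(* In clockwise order. *)
Definition tile_corners (i j : int) : seq (R * R) :=
  [seq tile_center i j + d |
     d <- [:: (0, 1); (Num.sqrt 3 / 2, 1 / 2); (Num.sqrt 3 / 2, - (1 / 2));
              (0, -1); (- (Num.sqrt 3 / 2), - (1 / 2));
              (- (Num.sqrt 3 / 2), 1 / 2)]].

Definition tile_sides (i j : int) : seq ((R * R) * (R * R)) :=
  zip (tile_corners i j) (rot 1 (tile_corners i j)).

(* The top corner of a tile if the class is [true], its upper left corner if
   the class is [false]. *)
Definition hex_pos (v : hex_vertex) : R * R :=
  let: (a, b, s) := v in
  tile_center a b + (if s then (0, 1) else (- (Num.sqrt 3 / 2), 1 / 2)).

Definition hex_tile (i j : int) : seq hex_vertex :=
  [:: ((i, j), true); ((i + 1, j), false); ((i + 1, j - 1), true);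
      ((i + 1, j - 1), false); ((i, j - 1), true); ((i, j), false)].

Lemma hex_pos_tile i j : map hex_pos (hex_tile i j) = tile_corners i j.
Proof.
rewrite /tile_corners /hex_tile /hex_pos /tile_center /= !rmorphB !rmorphD /=.
by do !congr cons; congr pair; rewrite /=; field.
Qed.

Lemma hex_pos_inj : injective hex_pos.
Proof.
have s3 : Num.sqrt 3 != 0 :> R by rewrite sqrtr_eq0 -ltNge; lra.
have zinj (m n : int) : m%:~R = n%:~R :> R -> m = n
  by move/eqP; rewrite eqr_int => /eqP.
move=> [[a b] s] [[c d] t]; rewrite /hex_pos /tile_center => -[].
case: s t => [] [] /= hx hy.
- have bd : b = d by apply: zinj; lra.
  subst d; congr (_, _, _); apply: zinj; apply: (mulfI s3).
  by move: hx; rewrite !mulrDr; lra.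
- have : 3 * b + 1 = 3 * d :> int; last by lia.
  by apply: zinj; rewrite rmorphD !rmorphM /=; lra.
- have : 3 * b = 3 * d + 1 :> int; last by lia.
  by apply: zinj; rewrite rmorphD !rmorphM /=; lra.
- have bd : b = d by apply: zinj; lra.
  subst d; congr (_, _, _); apply: zinj; apply: (mulfI s3).
  by move: hx; rewrite !mulrDr; lra.
Qed.

Lemma hex_vertexP (p : R * R) :
  (exists v, hex_pos v = p) <-> (exists i j, p \in tile_corners i j).
Proof.
split=> [[[[a b] s] <-]|[i [j]]]; last first.
  by rewrite -hex_pos_tile => /mapP[v _ ->]; exists v.
exists a, b; rewrite -hex_pos_tile (mem_map hex_pos_inj).
by case: s; rewrite !inE eqxx ?orbT.
Qed.

Lemma hex_edgeP (v w : hex_vertex) :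
  (w \in hex_nb v) <->
  (exists i j, (hex_pos v, hex_pos w) \in tile_sides i j \/
               (hex_pos w, hex_pos v) \in tile_sides i j).
Proof.
pose f (u : hex_vertex * hex_vertex) := (hex_pos u.1, hex_pos u.2).
have f_inj : injective f.
  by move=> [? ?] [? ?] [/hex_pos_inj -> /hex_pos_inj ->].
have sideE i j x y : ((hex_pos x, hex_pos y) \in tile_sides i j) =
    ((x, y) \in zip (hex_tile i j) (rot 1 (hex_tile i j))).
  rewrite /tile_sides -hex_pos_tile -map_rot -(mem_map f_inj).
  by congr (_ \in _).
split=> [|[i [j]]]; last first.
  have tileP x y : (x, y) \in zip (hex_tile i j) (rot 1 (hex_tile i j)) ->
    y \in hex_nb x.
    rewrite /= !inE => /or4P[||| /or3P[]] /eqP[-> ->];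
      rewrite !inE -!pair_eqE /= -!pair_eqE /=; lia.
  by rewrite !sideE => -[/tileP // | /tileP]; rewrite hex_nb_sym.
suff main (x y : hex_vertex) : x.2 -> y \in hex_nb x -> exists i j,
    (x, y) \in zip (hex_tile i j) (rot 1 (hex_tile i j)) \/
    (y, x) \in zip (hex_tile i j) (rot 1 (hex_tile i j)).
  case: (boolP v.2) => hv vw.
    by have [i [j H]] := main v w hv vw; exists i, j; rewrite !sideE.
  have hw : w.2.
    by move: v w vw hv => [[? ?] []] [[? ?] []]; rewrite ?inE -?pair_eqE /= ?andbF.
  have [i [j H]] := main w v hw (etrans (hex_nb_sym _ _) vw).
  by exists i, j; rewrite !sideE; case: H => H; [right | left].
case: x => [[a b] []] // _; rewrite !inE -orbA => /or3P[] /eqP->.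
- by exists a, b; right; rewrite /= !inE eqxx ?orbT.
- by exists a, b; left; rewrite /= !inE eqxx ?orbT.
- by exists a, (b + 1); left; rewrite /= addrK !inE eqxx ?orbT.
Qed.

End HexagonalTiling.

(* Main.v *)
Require Import Defs.
From mathcomp Require Import all_boot all_order all_algebra finmap.
From mathcomp Require Import reals.
From mathcomp Require Import zify ring lra.

Set Implicit Arguments.
Unset Strict Implicit.
Unset Printing Implicit Defensive.

Import Order.TTheory GRing.Theory Num.Theory.
Local Open Scope fset_scope.
Local Open Scope ring_scope.

(** Deleting one of the three directions of edges splits the grid into a family
    of bi-infinite zigzag paths. Let p, q, r be the numbers of zigzags of the
    three families that meet W.

    Adding to W an outside vertex with at least two neighbours in W does not
    increase |N(W)| and does not change p, q, r. Once no such vertex is left,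
    |N(W)| is the number of outgoing edges; every zigzag that meets W has two of
    them and every edge is on two zigzags, hence |N(W)| >= p + q + r.

    A vertex is determined by its class and two of its three zigzags, so
    |W| <= 2qr, and likewise for the other two pairs. If p, q, r satisfy the
    triangle inequalities, then 2|W| + (q + r - p)^2 <= 4qr: remove the
    outermost zigzag of the second and of the third family, which together
    contain at most 2p vertices of W, and conclude by induction. In all cases
    6|W| <= (p + q + r)^2, which is (1).

    (2) follows from |N(W)| <= |E(W)|, and (3) from (1) applied to W minus B(W).
    The hexagon attains equality in (1) and (2), and together with its
    neighbours it attains equality in (3). *)

(** * Cardinalities of finite sets *)

Lemma leq_card_fset_inj (K T : choiceType) (f : K -> T) (A : {fset K})
    (B : {fset T}) :
  {in A &, injective f} -> {in A, forall x, f x \in B} -> (#|` A| <= #|` B|)%N.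
Proof.
move=> finj fB.
have <- : #|` f @` A| = #|` A| by apply/eqP/card_in_imfsetP.
by apply/fsubset_leq_card/fsubsetP => _ /imfsetP[x /= xA ->]; exact: fB.
Qed.

Lemma leq_card_fset_surj (K T : choiceType) (f : K -> T) (A : {fset K})
    (B : {fset T}) :
  {in B, forall y, exists2 x, x \in A & f x = y} -> (#|` B| <= #|` A|)%N.
Proof.
move=> fA; have : (#|` f @` A| <= #|` A|)%N by exact: leq_imfset_card.
apply: leq_trans.
by apply/fsubset_leq_card/fsubsetP => y /fA[x xA <-]; apply: in_imfset.
Qed.

Lemma card_fsetM (K T : choiceType) (A : {fset K}) (B : {fset T}) :
  #|` A `*` B| = (#|` A| * #|` B|)%N.
Proof.
rewrite (perm_size (enum_imfset2 _ _)) ?size_allpairs //.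
by move=> [? ?] [? ?] _ _ /= [-> ->].
Qed.

Lemma leq_card_fset_seq (K : choiceType) (s : seq K) :
  (#|` [fset x in s]| <= size s)%N.
Proof. by rewrite card_fseq size_undup. Qed.

Lemma fset_argmax (K : choiceType) (t : K -> int) (A : {fset K}) x0 :
  x0 \in A -> exists2 m, m \in A & {in A, forall x, t x <= t m}.
Proof.
move=> x0A; pose i0 := FSetSub x0A.
have [i _ imax] :=
  @Order.TotalTheory.arg_maxP _ _ _ i0 xpredT (fun i => t (val i)) isT.
by exists (val i); [exact: valP | move=> x xA; exact: (imax (FSetSub xA))].
Qed.

(** * Neighbors, boundary and outgoing edges in a general graph *)

Section LocallyFinite.
Variables (V : choiceType) (nb : V -> {fset V}).
Implicit Type W : {fset V}.

(** An outgoing edge [e] determines its outer end, since [e] minus [W] is the singleton of that end.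
    The edges thus map onto the singletons of neighbor vertices. *)
Lemma leq_card_neighbor_outgoing W :
  (#|` neighbor_vertices nb W| <= #|` outgoing_edges nb W|)%N.
Proof.
have <- : #|` (@fset1 V) @` neighbor_vertices nb W| =
          #|` neighbor_vertices nb W|.
  by apply/eqP/card_in_imfsetP => x y _ _ /fset1_inj.
apply: (@leq_card_fset_surj _ _ (fun e => e `\` W)) => _ /imfsetP[x /= xN ->].
have /neighbor_verticesP[xW [y yW xy]] := xN.
exists [fset y; x]; first by apply/outgoing_edgesP; exists y, x.
apply/fsetP => z; rewrite !inE.
case: (eqVneq z x) => [->|]; first by rewrite xW orbT.
by case: (eqVneq z y) => [->|]; rewrite ?yW ?andbF.
Qed.

(** A vertex of [W] off the boundary has all its neighbors in [W], so a neighbor of the interior can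
    only be a boundary vertex. This transfers (1) to (3). *)
Lemma neighbor_interior W :
  neighbor_vertices nb (W `\` boundary_vertices nb W) `<=`
  boundary_vertices nb W.
Proof.
apply/fsubsetP => x /neighbor_verticesP[]; rewrite in_fsetD negb_and negbK.
move=> xB [y]; rewrite in_fsetD => /andP[yB yW] xy.
case/orP: xB => // xW; case/boundary_verticesP: yB.
by split=> //; exists x.
Qed.

(** Vertices of [W] have all their neighbors in the union, so only the added layer can be boundary.
    This serves the optimality in (3). *)
Lemma boundary_union_neighbor W :
  boundary_vertices nb (W `|` neighbor_vertices nb W) `<=`
  neighbor_vertices nb W.
Proof.
apply/fsubsetP => x /boundary_verticesP[]; rewrite in_fsetU => /orP[] // xW.
case=> y; rewrite in_fsetU negb_or => /andP[yW yN] yx.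
by case/neighbor_verticesP: yN; split=> //; exists x.
Qed.

End LocallyFinite.

(* The indices of the three zigzags through a vertex; crossing an edge of
   direction 0, 1, 2 ([hex_n0], [hex_n1], [hex_n2]) changes only the third, the
   first, the second of them. *)
Definition hex_a (v : hex_vertex) : int := v.1.1.
Definition hex_b (v : hex_vertex) : int := v.1.2.
Definition hex_c (v : hex_vertex) : int :=
  if v.2 then v.1.1 + v.1.2 else v.1.1 + v.1.2 - 1.

Definition hex_n0 (v : hex_vertex) : hex_vertex := (v.1, ~~ v.2).
Definition hex_n1 (v : hex_vertex) : hex_vertex :=
  if v.2 then ((v.1.1 + 1, v.1.2), false) else ((v.1.1 - 1, v.1.2), true).
Definition hex_n2 (v : hex_vertex) : hex_vertex :=
  if v.2 then ((v.1.1, v.1.2 + 1), false) else ((v.1.1, v.1.2 - 1), true).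

Lemma hex_nbE v : hex_nb v = [fset hex_n0 v; hex_n1 v; hex_n2 v].
Proof. by case: v => [[a b] []]. Qed.

Lemma hex_nbP v w :
  reflect [\/ w = hex_n0 v, w = hex_n1 v | w = hex_n2 v] (w \in hex_nb v).
Proof.
rewrite hex_nbE !inE -orbA; apply: (iffP or3P) => -[] /eqP E;
  by [constructor 1 | constructor 2 | constructor 3].
Qed.


(** * Two outside neighbors at the ends of each zigzag *)

(** Here [h] names the line through a vertex and [t] is the position on that line. *)
Definition beyond (V : choiceType) (h t : V -> int) (W U : {fset V}) :
    {fset V} :=
  [fset u in U | (u \notin W) &&
    [forall w : W, (h (val w) == h u) ==> (t (val w) < t u)]].

Lemma beyondP (V : choiceType) (h t : V -> int) (W U : {fset V}) u :
  reflect [/\ u \in U, u \notin W & {in W, forall w, h w = h u -> t w < t u}]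
          (u \in beyond h t W U).
Proof.
rewrite in_fset inE /=; apply: (iffP and3P) => -[uU uW tu]; split=> //.
  by move=> w wW /eqP hw; have := forallP tu (FSetSub wW); rewrite /= hw.
by apply/forallP => w; apply/implyP => /eqP; exact/tu/valP.
Qed.

(** On each line meeting [W], take the vertex of [W] with largest [t]: [f] or [g] moves it further
    along the same line, hence out of [W]. *)
Lemma leq_card_half_lines (V : choiceType) (h t : V -> int) (f g : V -> V)
    (W : {fset V}) :
    (forall v, h (f v) = h v) -> (forall v, h (g v) = h v) ->
    (forall v, t v < t (f v) \/ t v < t (g v)) ->
  (#|` h @` W| <=
   #|` beyond h t W (f @` W `|` g @` W)|)%N.
Proof.
move=> hf hg tfg; apply: (@leq_card_fset_surj _ _ h) => _ /imfsetP[w /= wW ->].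
pose L := [fset v in W | h v == h w].
have wL : w \in L by rewrite !inE wW /=.
have [m] := fset_argmax t wL; rewrite !inE => /andP[/= mW /eqP mw] mmax.
have key u : u \in f @` W `|` g @` W -> h u = h m -> t m < t u ->
    exists2 x, x \in beyond h t W (f @` W `|` g @` W) & h x = h w.
  move=> uI hu tu; exists u; last by rewrite hu.
  have above x : x \in W -> h x = h u -> t x < t u.
    move=> xW hx; apply: le_lt_trans tu; apply: mmax.
    by rewrite !inE xW /= hx hu mw.
  apply/beyondP; split=> //.
  by apply/negP => uW; have := above u uW erefl; rewrite ltxx.
case: (tfg m) => tm; [apply: (key (f m)) | apply: (key (g m))] => //;
  by rewrite in_fsetU in_imfset ?orbT.
Qed.

(** The half-line bound is applied to [t] and to [- t], that is, to both ends of each line. No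
    vertex lies past both ends, so the two contributions are disjoint. *)
Lemma leq_card_lines (V : choiceType) (h t : V -> int) (f g : V -> V)
    (W : {fset V}) :
    (forall v, h (f v) = h v) -> (forall v, h (g v) = h v) ->
    (forall v, t v < t (f v) /\ t (g v) < t v \/
               t v < t (g v) /\ t (f v) < t v) ->
  (2 * #|` h @` W| <= #|` f @` W `\` W| + #|` g @` W `\` W|)%N.
Proof.
move=> hf hg tfg; pose U := f @` W `|` g @` W.
pose above s := beyond h s W U.
have up : (#|` h @` W| <= #|` above t|)%N.
  by apply: leq_card_half_lines => // v; case: (tfg v) => -[? ?]; [left|right].
have dn : (#|` h @` W| <= #|` above (fun v => - t v)|)%N.
  apply: leq_card_half_lines => // v; rewrite !ltrN2.
  by case: (tfg v) => -[? ?]; [right|left].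
have aboveP s u : u \in above s -> exists2 w, w \in W & s w < s u /\ h w = h u.
  move/beyondP=> [uU _ au].
  have [w wW hw] : exists2 w, w \in W & h w = h u.
    by case/fsetUP: uU => /imfsetP[w /= wW ->]; exists w.
  by exists w => //; split=> //; apply: au.
have disj : above t `&` above (fun v => - t v) = fset0.
  apply/fsetP => u; rewrite in_fset0; apply/negP.
  case/fsetIP=> /aboveP[w wW [tw hw]].
  by case/beyondP=> _ _ /(_ w wW hw); rewrite ltrN2 ltNge (ltW tw).
have sub : above t `|` above (fun v => - t v) `<=`
    (f @` W `\` W) `|` (g @` W `\` W).
  rewrite -fsetDUl; apply/fsubsetP => u.
  by rewrite in_fsetD => /fsetUP[] /beyondP[-> -> _].
have := fsubset_leq_card sub.
rewrite cardfsU disj cardfs0 subn0.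
have := cardfsU (f @` W `\` W) (g @` W `\` W); lia.
Qed.

Lemma leq_card_zigzags_a (W : {fset hex_vertex}) :
  (2 * #|` hex_a @` W| <= #|` hex_n0 @` W `\` W| + #|` hex_n2 @` W `\` W|)%N.
Proof.
(* This position numbers the vertices of a zigzag by consecutive integers, the two classes
   alternating. *)
apply: (@leq_card_lines _ _ (fun v => 2 * hex_b v - (~~ v.2)%:Z));
  case=> [[a b] []]; rewrite /hex_a /hex_b /hex_n0 /hex_n2 /=; lia.
Qed.

Lemma leq_card_zigzags_b (W : {fset hex_vertex}) :
  (2 * #|` hex_b @` W| <= #|` hex_n0 @` W `\` W| + #|` hex_n1 @` W `\` W|)%N.
Proof.
apply: (@leq_card_lines _ _ (fun v => 2 * hex_a v - (~~ v.2)%:Z));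
  case=> [[a b] []]; rewrite /hex_a /hex_b /hex_n0 /hex_n1 /=; lia.
Qed.

Lemma leq_card_zigzags_c (W : {fset hex_vertex}) :
  (2 * #|` hex_c @` W| <= #|` hex_n1 @` W `\` W| + #|` hex_n2 @` W `\` W|)%N.
Proof.
apply: (@leq_card_lines _ _ (fun v => 2 * hex_a v - (~~ v.2)%:Z));
  case=> [[a b] []]; rewrite /hex_a /hex_c /hex_n1 /hex_n2 /=; lia.
Qed.

Lemma hex_n0K : involutive hex_n0.
Proof. by case=> [[a b] []]. Qed.

Lemma hex_n1K : involutive hex_n1.
Proof. by case=> [[a b] []]; rewrite /hex_n1 /= ?addrK ?subrK. Qed.

Lemma hex_n2K : involutive hex_n2.
Proof. by case=> [[a b] []]; rewrite /hex_n2 /= ?addrK ?subrK. Qed.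

Lemma mem_imfset_involutive (K : choiceType) (f : K -> K) (A : {fset K}) x :
  involutive f -> (x \in f @` A) = (f x \in A).
Proof.
move=> fK; apply/imfsetP/idP => /= [[y yA ->]|fxA]; first by rewrite fK.
by exists (f x); rewrite ?fK.
Qed.

Lemma hex_neighborE (W : {fset hex_vertex}) :
  neighbor_vertices hex_nb W =
  (hex_n0 @` W `\` W) `|` ((hex_n1 @` W `\` W) `|` (hex_n2 @` W `\` W)).
Proof.
apply/fsetP => x; rewrite -!fsetDUl in_fsetD !in_fsetU.
rewrite !mem_imfset_involutive; try
  by [exact: hex_n0K | exact: hex_n1K | exact: hex_n2K].
apply/neighbor_verticesP/andP => -[xW].
  case=> y yW; rewrite hex_nb_sym => /hex_nbP H; split=> //; apply/or3P.
  by case: H => <-; [constructor 1 | constructor 2 | constructor 3].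
move=> H; split=> //; case/or3P: H => H; eexists; try exact: H;
  rewrite hex_nb_sym; apply/hex_nbP;
  by [constructor 1 | constructor 2 | constructor 3].
Qed.

(** * Growing [W] to a closed set: |N(W)| >= p + q + r *)

(** The stable sets of bootstrap percolation with threshold two, written by pairs of directions to
    match the disjointness of the three parts of the neighborhood. *)
Definition bootstrap_closed (W : {fset hex_vertex}) :=
  forall v, v \notin W ->
  [/\ ~~ ((hex_n0 v \in W) && (hex_n1 v \in W)),
      ~~ ((hex_n0 v \in W) && (hex_n2 v \in W)) &
      ~~ ((hex_n1 v \in W) && (hex_n2 v \in W))].

(** Closedness makes the neighbors reached in the three directions disjoint. Adding the three zigzag
    bounds counts each direction twice, which cancels the factor 2. *)
Lemma leq_zigzags_closed (W : {fset hex_vertex}) :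
  bootstrap_closed W ->
  (#|` hex_a @` W| + #|` hex_b @` W| + #|` hex_c @` W| <=
   #|` neighbor_vertices hex_nb W|)%N.
Proof.
move=> clW; rewrite hex_neighborE.
have d12 : (hex_n1 @` W `\` W) `&` (hex_n2 @` W `\` W) = fset0.
  apply/fsetP => x; rewrite in_fset0 in_fsetI !in_fsetD.
  rewrite (mem_imfset_involutive _ _ hex_n1K)
    (mem_imfset_involutive _ _ hex_n2K).
  by case: (boolP (x \in W)) => //= /clW[_ _ /negbTE].
have d0 : (hex_n0 @` W `\` W) `&`
    ((hex_n1 @` W `\` W) `|` (hex_n2 @` W `\` W)) = fset0.
  apply/fsetP => x; rewrite in_fset0 in_fsetI in_fsetU !in_fsetD.
  rewrite (mem_imfset_involutive _ _ hex_n0K)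
    (mem_imfset_involutive _ _ hex_n1K).
  rewrite (mem_imfset_involutive _ _ hex_n2K).
  case: (boolP (x \in W)) => //= /clW[/negbTE h1 /negbTE h2 _].
  by rewrite andb_orr h1 h2.
rewrite cardfsU d0 cardfs0 subn0 cardfsU d12 cardfs0 subn0.
have := leq_card_zigzags_a W; have := leq_card_zigzags_b W.
have := leq_card_zigzags_c W; lia.
Qed.

(** The vertex [v] leaves the neighborhood, and only its third neighbor [z] can enter it. *)
Lemma leq_neighbor_add (W : {fset hex_vertex}) v x y z :
    hex_nb v =i [:: x; y; z] -> v \notin W -> x \in W -> y \in W ->
  (#|` neighbor_vertices hex_nb (v |` W)| <= #|` neighbor_vertices hex_nb W|)%N.
Proof.
move=> nbv vW xW yW.
have vN : v \in neighbor_vertices hex_nb W.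
  apply/neighbor_verticesP; split=> //; exists x => //.
  by rewrite hex_nb_sym nbv !inE eqxx.
have sub : neighbor_vertices hex_nb (v |` W) `<=`
    z |` (neighbor_vertices hex_nb W `\ v).
  apply/fsubsetP => u /neighbor_verticesP[]; rewrite in_fset1U negb_or.
  move=> /andP[uv uW] [w]; rewrite in_fset1U in_fset1U in_fsetD1 uv /=.
  case/orP=> [/eqP->|wW uw].
    rewrite nbv !inE => /or3P[/eqP ux|/eqP uy|->] //.
      by rewrite ux xW in uW.
    by rewrite uy yW in uW.
  by apply/orP; right; apply/neighbor_verticesP; split=> //; exists w.
apply: leq_trans (fsubset_leq_card sub) _.
by rewrite cardfsU1 (cardfsD1 v (neighbor_vertices _ _)) vN leq_add // leq_b1.
Qed.

Lemma imfset_add (K T : choiceType) (h : K -> T) (W : {fset K}) v x :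
  x \in W -> h v = h x -> h @` (v |` W) = h @` W.
Proof.
move=> xW hv; rewrite imfsetU1; apply/fsetP => i; rewrite in_fset1U hv.
by case: eqP => // ->; rewrite in_imfset.
Qed.

(** * Bounds on |W| in terms of p, q, r *)

Lemma leq_card_ab (W : {fset hex_vertex}) (A B : {fset int}) :
    {in W, forall v, hex_a v \in A} -> {in W, forall v, hex_b v \in B} ->
  (#|` W| <= 2 * #|` A| * #|` B|)%N.
Proof.
move=> WA WB; have -> : (2 * #|` A| * #|` B|)%N =
    #|` (A `*` B) `*` [fset true; false]|.
  by rewrite !card_fsetM cardfs2 /=; lia.
apply: (@leq_card_fset_inj _ _ (fun v => ((hex_a v, hex_b v), v.2))).
  move=> [[a b] s] [[a' b'] s'] _ _ []; rewrite /hex_a /hex_b /=.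
  by move=> -> -> ->.
by move=> v vW; rewrite !in_fsetM /= WA ?WB //= !inE; case: v.2.
Qed.

Lemma leq_card_ac (W : {fset hex_vertex}) (A C : {fset int}) :
    {in W, forall v, hex_a v \in A} -> {in W, forall v, hex_c v \in C} ->
  (#|` W| <= 2 * #|` A| * #|` C|)%N.
Proof.
move=> WA WC; have -> : (2 * #|` A| * #|` C|)%N =
    #|` (A `*` C) `*` [fset true; false]|.
  by rewrite !card_fsetM cardfs2 /=; lia.
apply: (@leq_card_fset_inj _ _ (fun v => ((hex_a v, hex_c v), v.2))).
  move=> [[a b] s] [[a' b'] s'] _ _ []; rewrite /hex_a /hex_c /= => -> h es.
  by move: h; rewrite -es; case: s {es} => h; congr (_, _, _); lia.
by move=> v vW; rewrite !in_fsetM /= WA ?WC //= !inE; case: v.2.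
Qed.

Lemma hex_bc_inj : injective (fun v => ((hex_b v, hex_c v), v.2)).
Proof.
move=> [[a b] s] [[a' b'] s'] []; rewrite /hex_b /hex_c /= => -> h es.
by move: h; rewrite -es; case: s {es} => h; congr (_, _, _); lia.
Qed.

Lemma leq_card_bc (W : {fset hex_vertex}) (B C : {fset int}) :
    {in W, forall v, hex_b v \in B} -> {in W, forall v, hex_c v \in C} ->
  (#|` W| <= 2 * #|` B| * #|` C|)%N.
Proof.
move=> WB WC; have -> : (2 * #|` B| * #|` C|)%N =
    #|` (B `*` C) `*` [fset true; false]|.
  by rewrite !card_fsetM cardfs2 /=; lia.
apply: leq_card_fset_inj (in2W hex_bc_inj) _.
by move=> v vW; rewrite !in_fsetM /= WB ?WC //= !inE; case: v.2.
Qed.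

Lemma leq_zigzags_neighbor (W : {fset hex_vertex}) :
  (#|` hex_a @` W| + #|` hex_b @` W| + #|` hex_c @` W| <=
   #|` neighbor_vertices hex_nb W|)%N.
Proof.
(* Induction on the room left in the bound |W| <= 2pq, with p and q fixed as [W] grows. *)
have [n] := ubnP (2 * #|` hex_a @` W| * #|` hex_b @` W| - #|` W|).
elim: n W => // n IH W Wn.
(* Each direction changes a single index, so of two neighbors in different directions at least one
   shares any given index with [v]. *)
have step v x y z : hex_nb v =i [:: x; y; z] -> v \notin W ->
    x \in W -> y \in W ->
    hex_a v = hex_a x \/ hex_a v = hex_a y ->
    hex_b v = hex_b x \/ hex_b v = hex_b y ->
    hex_c v = hex_c x \/ hex_c v = hex_c y ->
  (#|` hex_a @` W| + #|` hex_b @` W| + #|` hex_c @` W| <=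
   #|` neighbor_vertices hex_nb W|)%N.
  move=> nbv vW xW yW va vb vc.
  apply: leq_trans (leq_neighbor_add nbv vW xW yW).
  have Ea : hex_a @` (v |` W) = hex_a @` W by case: va => /imfset_add ->.
  have Eb : hex_b @` (v |` W) = hex_b @` W by case: vb => /imfset_add ->.
  have Ec : hex_c @` (v |` W) = hex_c @` W by case: vc => /imfset_add ->.
  have := IH (v |` W); rewrite Ea Eb Ec; apply.
  (* This bound shows that the truncated difference was positive, so it strictly decreases. *)
  have : (#|` v |` W| <= 2 * #|` hex_a @` W| * #|` hex_b @` W|)%N.
    by apply: leq_card_ab => w wW; rewrite -?Ea -?Eb in_imfset.
  by move: Wn; rewrite cardfsU1 vW; lia.
have [W_cl|] := boolP
  [forall v : neighbor_vertices hex_nb W,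
   [&& ~~ ((hex_n0 (val v) \in W) && (hex_n1 (val v) \in W)),
      ~~ ((hex_n0 (val v) \in W) && (hex_n2 (val v) \in W)) &
      ~~ ((hex_n1 (val v) \in W) && (hex_n2 (val v) \in W))]].
  (* Testing the neighbor vertices suffices: any other outside vertex has no neighbor in [W]. *)
  apply: leq_zigzags_closed => v vW.
  have [vN|vN] := boolP (v \in neighbor_vertices hex_nb W).
    by apply/and3P; exact: (forallP W_cl (FSetSub vN)).
  have out w : w \in hex_nb v -> w \notin W.
    move=> wv; apply: contra vN => wW; apply/neighbor_verticesP; split=> //.
    by exists w => //; rewrite hex_nb_sym.
  have /negbTE-> := out _ (introT (hex_nbP v _) (Or31 _ _ erefl)).
  by have /negbTE-> := out _ (introT (hex_nbP v _) (Or32 _ _ erefl)).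
rewrite negb_forall => /existsP[[v /= vN]].
have /neighbor_verticesP[vW _] := vN.
have nbv : hex_nb v =i [:: hex_n0 v; hex_n1 v; hex_n2 v].
  by move=> w; rewrite hex_nbE !inE orbA.
rewrite negb_and negbK negb_and !negbK => /or3P[] /andP[xW yW].
- apply: (step v _ _ (hex_n2 v) nbv vW xW yW);
    by case: (v) => [[a b] []]; rewrite /hex_a /hex_b /hex_c /=; lia.
- apply: (step v _ _ (hex_n1 v) _ vW xW yW);
    by [move=> w; rewrite nbv !inE (orbC (w == hex_n2 v)) |
        case: (v) => [[a b] []]; rewrite /hex_a /hex_b /hex_c /=; lia].
- apply: (step v _ _ (hex_n0 v) _ vW xW yW);
    by [move=> w; rewrite nbv !inE orbC orbA |
        case: (v) => [[a b] []]; rewrite /hex_a /hex_b /hex_c /=; lia].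
Qed.

(* Each zigzag of the first family has at most one vertex of each class on the
   two sides, which is why [v |-> (hex_a v, v.2)] is injective on [W]. *)
Lemma leq_card_two_sides (W : {fset hex_vertex}) (A : {fset int}) y z :
    {in W, forall v, [/\ hex_a v \in A, hex_b v <= y, hex_c v <= z &
                         hex_b v = y \/ hex_c v = z]} ->
  (#|` W| <= 2 * #|` A|)%N.
Proof.
move=> WA; have -> : (2 * #|` A|)%N = #|` A `*` [fset true; false]|.
  by rewrite card_fsetM cardfs2 mulnC.
apply: (@leq_card_fset_inj _ _ (fun v => (hex_a v, v.2))); last first.
  by move=> v /WA[vA _ _ _]; rewrite in_fsetM vA !inE; case: v.2.
move=> [[a b] s] [[a' b'] s'] /WA[_ + + +] /WA[_ + + +] [].
rewrite /hex_a /hex_b /hex_c /= => hb hc h hb' hc' h' ea es.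
subst a' s'; case: s hc h hc' h' => hc h hc' h'; congr (_, _, _); lia.
Qed.

(* With y and z the maxima of B and C, the values c - y <= z - y and
   z - b + 1 > z - y of [hex_a] are pairwise distinct, so one of them is not in
   A and the corresponding vertex is missing. *)
Lemma ltn_card_bc (W : {fset hex_vertex}) (A B C : {fset int}) :
    {in W, forall v, [/\ hex_a v \in A, hex_b v \in B & hex_c v \in C]} ->
    B != fset0 -> C != fset0 -> (#|` A| < #|` B| + #|` C|)%N ->
  (#|` W| < 2 * #|` B| * #|` C|)%N.
Proof.
move=> WABC /fset0Pn[b0 b0B] /fset0Pn[c0 c0C] ltA.
have [y yB ymax] := fset_argmax id b0B.
have [z zC zmax] := fset_argmax id c0C.
pose X := (fun c : int => c - y) @` C `|` (fun b : int => z - b + 1) @` B.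
have cX : #|` X| = (#|` B| + #|` C|)%N.
  have dX : [fset c - y | c in C] `&` [fset z - b + 1 | b in B] = fset0.
    apply/fsetP => x; rewrite in_fset0; apply/negP.
    case/fsetIP=> /imfsetP[c /= cC ->] /imfsetP[b /= bB].
    have := ymax b bB; have := zmax c cC; rewrite /=; lia.
  rewrite cardfsU dX cardfs0 subn0 !card_imfset /=; first by rewrite addnC.
    by move=> b b'; lia.
  by move=> c c'; lia.
have [x xX xA] : exists2 x, x \in X & x \notin A.
  apply/fsubsetPn; apply: contraL ltA => /fsubset_leq_card.
  by rewrite cX -leqNgt.
have miss (t : int * int * bool) : t \in B `*` C `*` [fset true; false] ->
    {in W, forall v, ((hex_b v, hex_c v), v.2) <> t} ->
    (#|` W| < 2 * #|` B| * #|` C|)%N.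
  move=> tBC tW; have -> : (2 * #|` B| * #|` C|)%N =
      #|` B `*` C `*` [fset true; false]|.
    by rewrite !card_fsetM cardfs2 /=; lia.
  rewrite (cardfsD1 t (_ `*` _)) tBC add1n ltnS.
  apply: leq_card_fset_inj (in2W hex_bc_inj) _ => v vW.
  have [_ vB vC] := WABC v vW.
  rewrite in_fsetD1 !in_fsetM /= vB vC !inE.
  by case: v.2 (tW v vW) => /eqP/negPf ->.
(* A vertex of class [true] with indices [y] and [i] has [hex_a] equal to [i - y]; one of class
   [false] with indices [i] and [z] has [z - i + 1]. *)
case/fsetUP: xX => /imfsetP[/= i iI xE].
  apply: (miss (y, i, true)); first by rewrite !in_fsetM /= yB iI !inE.
  move=> [[a b] s] vW [bE cE sE]; move: bE cE; rewrite /hex_b /hex_c sE /=.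
  move=> bE cE; case/negP: xA; have [] := WABC _ vW; rewrite /hex_a /=.
  by have -> : x = a by lia.
apply: (miss (i, z, false)); first by rewrite !in_fsetM /= zC iI !inE.
move=> [[a b] s] vW [bE cE sE]; move: bE cE; rewrite /hex_b /hex_c sE /=.
move=> bE cE; case/negP: xA; have [] := WABC _ vW; rewrite /hex_a /=.
by have -> : x = a by lia.
Qed.

(** Strong induction, since peeling two zigzags lowers [n] by 2 and leaves [A] fixed. The step
    balances exactly: 4qr - 4(q-1)(r-1) = 4p + n^2 - (n-2)^2 when q + r = p + n. *)
Lemma leq_card_hexagon (n : nat) (W : {fset hex_vertex}) (A B C : {fset int}) :
    {in W, forall v, [/\ hex_a v \in A, hex_b v \in B & hex_c v \in C]} ->
    (#|` A| + n = #|` B| + #|` C|)%N ->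
    (#|` B| <= #|` A| + #|` C|)%N -> (#|` C| <= #|` A| + #|` B|)%N ->
  (2 * #|` W| + n ^ 2 <= 4 * #|` B| * #|` C|)%N.
Proof.
have [m] := ubnP n; elim: m n W B C => // m IH n W B C ltm WABC eqn leB leC.
have le_bc : (#|` W| <= 2 * #|` B| * #|` C|)%N.
  by apply: leq_card_bc => v /WABC[].
case: n eqn ltm => [|n] eqn ltm; first by lia.
(* If [B] were empty, |A| + n = |C| <= |A| would contradict n > 0; likewise for [C]. *)
have B0 : B != fset0 by rewrite -cardfs_eq0; lia.
have C0 : C != fset0 by rewrite -cardfs_eq0; lia.
case: n eqn ltm => [|n] eqn ltm.
  have : (#|` W| < 2 * #|` B| * #|` C|)%N
    by apply: (ltn_card_bc WABC) => //; lia.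
  by lia.
have /fset0Pn[b0 b0B] := B0; have /fset0Pn[c0 c0C] := C0.
have [y yB ymax] := fset_argmax id b0B.
have [z zC zmax] := fset_argmax id c0C.
pose S := [fset v in W | (hex_b v == y) || (hex_c v == z)].
have SW : S `<=` W by apply/fsubsetP => v; rewrite in_fset inE => /andP[].
have cS : (#|` S| <= 2 * #|` A|)%N.
  apply: (@leq_card_two_sides _ _ y z) => v; rewrite in_fset inE /=.
  case/andP=> /WABC[vA vB vC] yz; split; rewrite ?ymax ?zmax //.
  by case/orP: yz => /eqP; [left|right].
have cB := cardfsD1 y B; have cC := cardfsD1 z C.
rewrite yB in cB; rewrite zC in cC.
have : (2 * #|` W `\` S| + n ^ 2 <= 4 * #|` B `\ y| * #|` C `\ z|)%N.
  apply: IH; try lia; move=> v.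
  rewrite in_fsetD in_fset inE /= negb_and negb_or.
  case/andP=> + vW; rewrite vW /= => /andP[vy vz]; have [vA vB vC] := WABC v vW.
  by rewrite !in_fsetD1 vy vz.
have := fsubset_leq_card SW; rewrite (cardfsDS SW).
move: #|` W| #|` S| #|` A| #|` B| #|` C| #|` B `\ y| #|` C `\ z|
  le_bc cS cB cC eqn.
clear.
nia.
Qed.

Lemma leq_card_zigzags_sqr (W : {fset hex_vertex}) :
  (6 * #|` W| <= (#|` hex_a @` W| + #|` hex_b @` W| + #|` hex_c @` W|) ^ 2)%N.
Proof.
set A := hex_a @` W; set B := hex_b @` W; set C := hex_c @` W.
have WA : {in W, forall v, hex_a v \in A} by move=> v vW; apply: in_imfset.
have WB : {in W, forall v, hex_b v \in B} by move=> v vW; apply: in_imfset.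
have WC : {in W, forall v, hex_c v \in C} by move=> v vW; apply: in_imfset.
have := leq_card_ab WA WB; have := leq_card_ac WA WC.
have := leq_card_bc WB WC.
have WABC : {in W, forall v, [/\ hex_a v \in A, hex_b v \in B & hex_c v \in C]}.
  by move=> v vW; rewrite WA ?WB ?WC.
have := @leq_card_hexagon (#|` B| + #|` C| - #|` A|) W A B C WABC.
move: #|` W| #|` A| #|` B| #|` C| => w p q r hex bc ac ab.
(* When x + y <= u, 12xy <= 3(x + y)^2 <= (2(x + y))^2 <= (x + y + u)^2. *)
have thin x y u : (w <= 2 * x * y -> x + y <= u -> 6 * w <= (x + y + u) ^ 2)%N.
  by move=> + le_u; have := leq_sqr (2 * (x + y)) (x + y + u); clear hex; nia.
have [le1|lt1] := leqP (q + r) p; first by rewrite -addnA addnC thin.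
have [le2|lt2] := leqP (p + r) q; first by rewrite addnAC thin.
have [le3|lt3] := leqP (p + q) r; first by rewrite thin.
have [n eqn] : exists n, (q + r = p + n)%N by exists (q + r - p)%N; lia.
have : (2 * w + n ^ 2 <= 4 * q * r)%N.
  have nE : (q + r - p)%N = n by lia.
  by rewrite nE in hex; apply: hex; lia.
(* With p = q + r - n, this sum of squares equals (p + q + r)^2 - 3(4qr - n^2). *)
have : (0 <= ((q + r)%:Z - 2 * n%:Z) ^+ 2 + 3 * (q%:Z - r%:Z) ^+ 2 :> int).
  by apply: addr_ge0; [|apply: mulr_ge0 => //]; exact: sqr_ge0.
clear hex; nia.
Qed.

Lemma neighbor_isoperimetry (W : {fset hex_vertex}) :
  (6 * #|` W| <= #|` neighbor_vertices hex_nb W| ^ 2)%N.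
Proof.
apply: leq_trans (leq_card_zigzags_sqr W) _.
by rewrite leq_exp2r // leq_zigzags_neighbor.
Qed.

(** * The extremal hexagon *)

Definition hexagon : {fset hex_vertex} := [fset v in hex_tile 0 0].

Lemma card_hexagon : #|` hexagon| = 6%N.
Proof. by rewrite card_fseq undup_id. Qed.

Lemma leq_neighbor_hexagon : (#|` neighbor_vertices hex_nb hexagon| <= 6)%N.
Proof.
pose s : seq hex_vertex := [:: ((0, 1), false); ((1, 0), true);
  ((2, -1), false); ((1, -2), true); ((0, -1), false); ((-1, 0), true)].
apply: leq_trans (leq_card_fset_seq s); apply/fsubset_leq_card/fsubsetP => x.
case/neighbor_verticesP; rewrite !in_fset => xH [y].
rewrite in_fset /= => yH xy; move: yH xy xH.
rewrite !inE => /or4P[||| /or3P[]] /eqP->;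
  by rewrite !inE -?orbA => /or3P[] /eqP->.
Qed.

Lemma leq_outgoing_hexagon : (#|` outgoing_edges hex_nb hexagon| <= 6)%N.
Proof.
pose s : seq (hex_vertex * hex_vertex) :=
  [:: (((0, 0), true), ((0, 1), false)); (((1, 0), false), ((1, 0), true));
      (((1, -1), true), ((2, -1), false)); (((1, -1), false), ((1, -2), true));
      (((0, -1), true), ((0, -1), false)); (((0, 0), false), ((-1, 0), true))].
apply: leq_trans (leq_card_fset_seq [seq [fset e.1; e.2] | e <- s]).
apply/fsubset_leq_card/fsubsetP => _ /outgoing_edgesP[x [y [-> + + +]]].
rewrite !in_fset => yx xH yH.
apply: (map_f (fun e => [fset e.1; e.2]) (x := (x, y))).
move: xH yx yH.
rewrite !inE => /or4P[||| /or3P[]] /eqP->;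
  by rewrite !inE -?orbA => /or3P[] /eqP->.
Qed.

(** * Passage to real inequalities *)

Section Bounds.
Variable R : realType.
Implicit Types (w n : nat) (c : R).

Lemma sqrt6M_le w n :
  (6 * w <= n ^ 2)%N -> Num.sqrt 6 * Num.sqrt w%:R <= n%:R :> R.
Proof.
move=> le_wn; rewrite -sqrtrM ?ler0n // -(ger0_norm (ler0n R n)) -sqrtr_sqr.
by rewrite ler_sqrt ?sqr_ge0 // -natrM -natrX ler_nat.
Qed.

(** After moving 6/2 = 3 to the right and squaring, the claim reads 6w + 9 <= (n + 3)^2. *)
Lemma sqrt6_boundary_le w n : (6 * w <= n ^ 2 + 6 * n)%N ->
  Num.sqrt 6 * Num.sqrt (w%:R + Num.sqrt 6 ^+ 2 / 4) - Num.sqrt 6 ^+ 2 / 2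
  <= n%:R :> R.
Proof.
move=> le_wn; rewrite sqr_sqrtr ?ler0n // lerBlDr -sqrtrM ?ler0n //.
have n0 : 0 <= n%:R + 6 / 2 :> R by have := ler0n R n; lra.
rewrite -(ger0_norm n0) -sqrtr_sqr ler_sqrt ?sqr_ge0 //.
have : (6 * w)%:R <= (n ^ 2 + 6 * n)%:R :> R by rewrite ler_nat.
by rewrite natrD natrX !natrM; lra.
Qed.

Lemma sqrt6_lt_sqr c : Num.sqrt 6 < c -> 6 < c ^+ 2.
Proof.
move=> lt6c; rewrite -[ltLHS]sqr_sqrtr ?ler0n // ltr_pXn2r //;
  rewrite nnegrE ?sqrtr_ge0 //.
exact: le_trans (sqrtr_ge0 6) (ltW lt6c).
Qed.

Lemma lt_neighbor_const c n : Num.sqrt 6 < c -> (n <= 6)%N ->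
  n%:R < c * Num.sqrt 6%:R.
Proof.
move=> lt6c len; have n6 : n%:R <= 6 :> R by rewrite ler_nat.
apply: le_lt_trans n6 _; rewrite -[ltLHS]sqr_sqrtr ?ler0n // expr2.
by rewrite ltr_pM2r // sqrtr_gt0 ltr0n.
Qed.

(** With k = c^2, squaring reduces the claim to n^2 < k(w - n), and k(w - n) >= 6k > 36 >= n^2. Thus
    upper bounds on the neighborhood and boundary of the hexagon suffice. *)
Lemma lt_boundary_const c w n :
    Num.sqrt 6 < c -> (n <= 6)%N -> (n + 6 <= w)%N ->
  n%:R < c * Num.sqrt (w%:R + c ^+ 2 / 4) - c ^+ 2 / 2.
Proof.
move=> lt6c len lew; have c6 := sqrt6_lt_sqr lt6c.
have c0 : 0 <= c by exact: le_trans (sqrtr_ge0 6) (ltW lt6c).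
have n0 : 0 <= n%:R :> R by exact: ler0n.
have n6 : n%:R <= 6 :> R by rewrite ler_nat.
have w6 : n%:R + 6 <= w%:R :> R by rewrite -natrD ler_nat.
rewrite ltrBrDr -ltr_sqr ?nnegrE ?mulr_ge0 ?sqrtr_ge0 //; last by lra.
rewrite exprMn sqr_sqrtr; last by lra.
move: (c ^+ 2) c6 => k c6; nra.
Qed.

End Bounds.

Theorem theorem1 (R : realType) :
  (forall W : {fset hex_vertex},
    [/\ Num.sqrt 6 * Num.sqrt #|` W|%:R
          <= #|` neighbor_vertices hex_nb W|%:R :> R,
        Num.sqrt 6 * Num.sqrt #|` W|%:R
          <= #|` outgoing_edges hex_nb W|%:R :> R
      & let c := Num.sqrt 6 in
        c * Num.sqrt (#|` W|%:R + c ^+ 2 / 4) - c ^+ 2 / 2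
          <= #|` boundary_vertices hex_nb W|%:R :> R])
  /\
  (forall c : R, Num.sqrt 6 < c ->
    [/\ exists W : {fset hex_vertex},
          ~ (c * Num.sqrt #|` W|%:R
               <= #|` neighbor_vertices hex_nb W|%:R),
        exists W : {fset hex_vertex},
          ~ (c * Num.sqrt #|` W|%:R
               <= #|` outgoing_edges hex_nb W|%:R)
      & exists W : {fset hex_vertex},
          ~ (c * Num.sqrt (#|` W|%:R + c ^+ 2 / 4) - c ^+ 2 / 2
               <= #|` boundary_vertices hex_nb W|%:R)]).
Proof.
split=> [W|c lt6c]; split.
- exact/sqrt6M_le/neighbor_isoperimetry.
- apply: sqrt6M_le; apply: leq_trans (neighbor_isoperimetry W) _.
  by rewrite leq_exp2r // leq_card_neighbor_outgoing.
- apply: sqrt6_boundary_le; set B := boundary_vertices hex_nb W.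
  have BW : B `<=` W by apply/fsubsetP => x /boundary_verticesP[].
  have leB := fsubset_leq_card BW.
  (* Here (1) gives 6(|W| - |B|) <= |N(W minus B)|^2 <= |B|^2. *)
  have := neighbor_isoperimetry (W `\` B); rewrite (cardfsDS BW).
  have : (#|` neighbor_vertices hex_nb (W `\` B)| ^ 2 <= #|` B| ^ 2)%N.
    by rewrite leq_exp2r // fsubset_leq_card // neighbor_interior.
  by lia.
- exists hexagon; apply/negP; rewrite -ltNge card_hexagon.
  exact: lt_neighbor_const lt6c leq_neighbor_hexagon.
- exists hexagon; apply/negP; rewrite -ltNge card_hexagon.
  exact: lt_neighbor_const lt6c leq_outgoing_hexagon.
- exists (hexagon `|` neighbor_vertices hex_nb hexagon).
  have leB := fsubset_leq_card (boundary_union_neighbor hex_nb hexagon).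
  apply/negP; rewrite -ltNge; apply: lt_boundary_const => //.
    exact: leq_trans leB leq_neighbor_hexagon.
  rewrite cardfsU card_hexagon.
  have -> : hexagon `&` neighbor_vertices hex_nb hexagon = fset0.
    apply/fsetP => x; rewrite in_fset0; apply/negP => /fsetIP[xH].
    by case/neighbor_verticesP; rewrite xH.
  by rewrite cardfs0 subn0 addnC leq_add2l.
Qed.
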